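(* Let $G$ be a group that admits a presentation $\langle S \mid r\rangle$ with a single relator $r$, where $S$ is a finite set with $|S|\geq 3$ and $r$ is a cyclically reduced non-empty word over $S\sqcup S^{-1}$. Then $G$ is not periodically rigid.
   Context: A presentation $\langle S\mid r\rangle$ of $G$ means that $G$ is isomorphic to $\mathcal{F}(S)/N(r)$, where $\mathcal{F}(S)$ is the free group on $S$ and $N(r)$ is the normal closure of $r$ in $\mathcal{F}(S)$. A word over $S\sqcup S^{-1}$ is cyclically reduced if it and all its cyclic permutations contain no factor $ss^{-1}$ or $s^{-1}s$ with $s\in S$. Let $G$ be a finitely generated group and $A$ a finite set (alphabet). $G$ acts on $A^G$ by $(g\cdot x)_h := x_{g^{-1}h}$. A pattern is an element $p\in A^{P}$ with $P\subseteq G$ finite; $p$ appears in $x\in A^G$ if there is $g\in G$ with $(g\cdot x)_h=p_h$ for all $h\in P$. For a set $\mathcal{F}$ of patterns, $X_{\mathcal{F}}\subseteq A^G$ is the set of all $x\in A^G$ in which no pattern of $\mathcal{F}$ appears. A subshift of finite type (SFT) on $G$ is a set of the form $X_{\mathcal{F}}$ with $\mathcal{F}$ finite (for some finite alphabet $A$). A configuration $x$ is strongly periodic if its orbit $\{g\cdot x\mid g\in G\}$ is finite, and weakly periodic if its stabilizer $\{g\in G\mid g\cdot x=x\}$ is nontrivial. A subshift is weakly aperiodic if it is nonempty and contains no strongly periodic configuration; it is strongly aperiodic if it is nonempty and contains no weakly periodic configuration. $G$ is periodically rigid if there is no SFT on $G$ (over any finite alphabet) that is weakly aperiodic but not strongly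 aperiodic. *)

(* Defs.v *)
From HB Require Import structures.
From mathcomp Require Import all_boot finmap.
From mathcomp Require Import boolp classical_sets cardinality.

Set Implicit Arguments.
Unset Strict Implicit.
Unset Printing Implicit Defensive.

Local Open Scope classical_set_scope.
Local Open Scope group_scope.
Local Open Scope quotient_scope.

(* A word over S and its formal inverses: the letter (s, true) stands for s,  *)
(* the letter (s, false) for s^-1.                                            *)
Notation word S := (seq (S * bool)).

Definition inv_letter (S : Type) (a : S * bool) : S * bool := (a.1, ~~ a.2).

Definition reduced (S : eqType) (w : word S) : bool :=
  sorted (fun a b => b != inv_letter a) w.

Definition cyclically_reduced (S : eqType) (w : word S) : Prop :=
  forall n : nat, reduced (rot n w).

(* The free group on S: reduced words, multiplied by concatenating and then   *)
(* cancelling.                                                                *)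
Section FreeGroup.
Variable S : choiceType.
Implicit Types (a b : S * bool) (u v w : word S).

Definition cons_letter a w : word S :=
  if w is b :: w' then (if b == inv_letter a then w' else a :: w) else [:: a].

Definition cat_reduce u v : word S := foldr cons_letter v u.

Definition inv_word w : word S := rev [seq inv_letter a | a <- w].

Lemma inv_letterK : involutive (@inv_letter S).
Proof. by case=> s e; rewrite /inv_letter /= negbK. Qed.

Lemma reduced_cons_letter a w : reduced w -> reduced (cons_letter a w).
Proof.
case: w => [|b w] //= rw; case: eqP => [_|/eqP nab]; first exact: path_sorted rw.
by rewrite /reduced /= nab.
Qed.

Lemma reduced_cat_reduce u v : reduced v -> reduced (cat_reduce u v).
Proof. by move=> rv; elim: u => //= a u; exact: reduced_cons_letter. Qed.

Lemma cons_letterK a w :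
  reduced w -> cons_letter a (cons_letter (inv_letter a) w) = w.
Proof.
case: w => [|b w] /=; first by rewrite eqxx.
rewrite inv_letterK; case: eqP => [-> | _] /=; last by rewrite eqxx.
by case: w => [|c w] //= /andP[/negPf-> _].
Qed.

Lemma cat_reduceA u v w : reduced w ->
  cat_reduce u (cat_reduce v w) = cat_reduce (cat_reduce u v) w.
Proof.
move=> rw; elim: u => //= a u ->.
case: (cat_reduce u v) => [|b t] //=; case: eqP => [->|_] //=.
by rewrite cons_letterK //; exact: reduced_cat_reduce.
Qed.

Lemma cat_reduce0 w : reduced w -> cat_reduce w [::] = w.
Proof.
elim: w => //= a w IHw raw; rewrite IHw; last exact: path_sorted raw.
by case: w raw {IHw} => //= b w /andP[/negPf-> _].
Qed.

Lemma reduced_inv_word w : reduced w -> reduced (inv_word w).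
Proof.
rewrite /reduced /inv_word rev_sorted sorted_map; apply: sub_sorted => a b /=.
by apply: contra_neq => eab; rewrite eab inv_letterK.
Qed.

Lemma cat_reduceNw w v : reduced v ->
  cat_reduce (inv_word w) (cat_reduce w v) = v.
Proof.
elim: w v => //= a w IHw v rv.
rewrite /inv_word /= rev_cons -cats1 /cat_reduce foldr_cat /=.
have := @cons_letterK (inv_letter a) (cat_reduce w v) (reduced_cat_reduce w rv).
by rewrite inv_letterK => ->; exact: IHw.
Qed.

Lemma inv_wordK w : inv_word (inv_word w) = w.
Proof.
rewrite /inv_word map_rev revK -map_comp map_id_in // => a _ /=.
exact: inv_letterK.
Qed.

Record free_group : Type :=
  FreeGroup { fg_word : word S; fg_reduced : reduced fg_word }.

HB.instance Definition _ := [isSub for fg_word].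
HB.instance Definition _ := [Choice of free_group by <:].

Definition free_of_word w : free_group :=
  FreeGroup (@reduced_cat_reduce w [::] isT).

Definition free_one : free_group := @FreeGroup [::] isT.
Definition free_mul (x y : free_group) : free_group :=
  FreeGroup (reduced_cat_reduce (fg_word x) (fg_reduced y)).
Definition free_inv (x : free_group) : free_group :=
  FreeGroup (reduced_inv_word (fg_reduced x)).

Lemma free_mulA : associative free_mul.
Proof. by move=> x y z; apply: val_inj; exact: cat_reduceA (fg_reduced z). Qed.

Lemma free_mul1g : left_id free_one free_mul.
Proof. by move=> x; apply: val_inj. Qed.

Lemma free_mulg1 : right_id free_one free_mul.
Proof. by move=> x; apply: val_inj; exact: cat_reduce0 (fg_reduced x). Qed.

Lemma free_mulVg : left_inverse free_one free_inv free_mul.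
Proof.
move=> x; apply: val_inj => /=.
by rewrite -{2}[fg_word x]cat_reduce0 ?cat_reduceNw // fg_reduced.
Qed.

Lemma free_mulgV : right_inverse free_one free_inv free_mul.
Proof.
move=> x; rewrite -{1}[x](_ : free_inv (free_inv x) = x) ?free_mulVg //.
by apply: val_inj; exact: inv_wordK.
Qed.

HB.instance Definition _ :=
  isGroup.Build free_group free_mulA free_mul1g free_mulg1 free_mulVg free_mulgV.

End FreeGroup.

Definition is_normal_subgroup (G : groupType) (N : set G) : Prop :=
  [/\ N 1, (forall x y, N x -> N y -> N (x * y)),
      (forall x, N x -> N x^-1) & (forall x g, N x -> N (x ^ g))].

Record normal_subgroup (G : groupType) : Type := NormalSubgroup {
  nsub_set : set G;
  nsubP : is_normal_subgroup nsub_set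
}.

Lemma smallest_is_normal (G : groupType) (A : set G) :
  is_normal_subgroup (smallest (@is_normal_subgroup G) A).
Proof.
split=> [M [[M1 _ _ _] _] // | x y Nx Ny M MA | x Nx M MA | x g Nx M MA];
  have [[_ MM MV MJ] _] := MA.
- by apply: MM; [exact: Nx|exact: Ny].
- by apply: MV; exact: Nx.
- by apply: MJ; exact: Nx.
Qed.

Definition normal_closure (G : groupType) (r : G) : normal_subgroup G :=
  NormalSubgroup (smallest_is_normal [set r]).

Section QuotientGroup.
Variables (G : groupType) (N : normal_subgroup G).

Definition coset_rel (x y : G) : bool := `[< nsub_set N (x^-1 * y) >].

Lemma coset_rel_refl : reflexive coset_rel.
Proof. by move=> x; apply/asboolP; rewrite mulVg; case: (nsubP N). Qed.

Lemma coset_rel_sym : symmetric coset_rel.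
Proof.
have [_ _ NV _] := nsubP N.
by move=> x y; apply/asboolP/asboolP => /NV; rewrite invgM invgK.
Qed.

Lemma coset_rel_trans : transitive coset_rel.
Proof.
have [_ NM _ _] := nsubP N.
move=> y x z /asboolP Nxy /asboolP Nyz; apply/asboolP.
by have := NM _ _ Nxy Nyz; rewrite -mulgA mulVKg.
Qed.

Canonical coset_equiv :=
  EquivRel coset_rel coset_rel_refl coset_rel_sym coset_rel_trans.

Definition quotient_group : Type := {eq_quot coset_rel}.

HB.instance Definition _ := Choice.on quotient_group.
HB.instance Definition _ := EqQuotient.on quotient_group.

Definition quot_one : quotient_group := \pi_quotient_group 1.
Definition quot_mul (x y : quotient_group) : quotient_group :=
  \pi_quotient_group (repr x * repr y).
Definition quot_inv (x : quotient_group) : quotient_group :=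
  \pi_quotient_group (repr x)^-1.

Lemma quot_eqP (x y : G) :
  reflect (nsub_set N (x^-1 * y)) (\pi_quotient_group x == \pi_quotient_group y).
Proof. by rewrite eqmodE; exact: asboolP. Qed.

Lemma repr_pi (x : G) : nsub_set N (x^-1 * repr (\pi_quotient_group x)).
Proof. by apply/quot_eqP; rewrite reprK. Qed.

Lemma quot_mulE (x y : G) :
  quot_mul (\pi_quotient_group x) (\pi_quotient_group y)
  = \pi_quotient_group (x * y).
Proof.
have [_ NM _ NJ] := nsubP N; apply/esym/eqP/quot_eqP.
have Nx := repr_pi x; have Ny := repr_pi y.
have := NM _ _ (NJ _ y Nx) Ny.
by rewrite /conjg invgM -!mulgA mulVKg.
Qed.

Lemma quot_invE (x : G) :
  quot_inv (\pi_quotient_group x) = \pi_quotient_group x^-1.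
Proof.
have [_ NM NV NJ] := nsubP N; apply/eqP/quot_eqP.
have := NJ _ x^-1 (repr_pi x).
by rewrite invgK /conjg invgK mulgA mulVKg.
Qed.

Lemma quot_mulA : associative quot_mul.
Proof.
move=> x y z; rewrite -(reprK x) -(reprK y) -(reprK z).
by rewrite (quot_mulE (repr y)) !(quot_mulE (repr x)) quot_mulE mulgA.
Qed.

Lemma quot_mul1g : left_id quot_one quot_mul.
Proof. by move=> x; rewrite -(reprK x) quot_mulE mul1g. Qed.

Lemma quot_mulg1 : right_id quot_one quot_mul.
Proof. by move=> x; rewrite -(reprK x) quot_mulE mulg1. Qed.

Lemma quot_mulVg : left_inverse quot_one quot_inv quot_mul.
Proof. by move=> x; rewrite -(reprK x) quot_invE quot_mulE mulVg. Qed.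

Lemma quot_mulgV : right_inverse quot_one quot_inv quot_mul.
Proof. by move=> x; rewrite -(reprK x) quot_invE quot_mulE mulgV. Qed.

HB.instance Definition _ := isGroup.Build quotient_group
  quot_mulA quot_mul1g quot_mulg1 quot_mulVg quot_mulgV.

End QuotientGroup.

Definition isomorphic (G H : groupType) : Prop :=
  exists f : {multiplicative G -> H}, bijective f.

Definition one_relator_presentation (G : groupType) (S : choiceType)
    (r : word S) : Prop :=
  isomorphic G (quotient_group (normal_closure (free_of_word r))).

Section Subshifts.
Variable G : groupType.

Definition shift (A : Type) (g : G) (x : G -> A) : G -> A :=
  fun h => x (g^-1 * h).

(* A pattern is a finite partial map; its support is the domain of the map. *)
Definition appears (A : Type) (p : {fmap G -> A}) (x : G -> A) : Prop :=
  exists g : G, forall h : domf p, shift g x (val h) = p h.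

Definition subshift (A : Type) (F : set {fmap G -> A}) : set (G -> A) :=
  [set x | forall p, F p -> ~ appears p x].

Definition SFT (A : Type) (X : set (G -> A)) : Prop :=
  exists F : set {fmap G -> A}, finite_set F /\ X = subshift F.

Definition strongly_periodic (A : Type) (x : G -> A) : Prop :=
  finite_set (range (fun g : G => shift g x)).

Definition stabilizer (A : Type) (x : G -> A) : set G :=
  [set g | shift g x = x].

Definition weakly_periodic (A : Type) (x : G -> A) : Prop :=
  stabilizer x <> [set 1].

Definition weakly_aperiodic (A : Type) (X : set (G -> A)) : Prop :=
  X !=set0 /\ ~ exists2 x, X x & strongly_periodic x.

Definition strongly_aperiodic (A : Type) (X : set (G -> A)) : Prop :=
  X !=set0 /\ ~ exists2 x, X x & weakly_periodic x.

Definition periodically_rigid : Prop :=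
  ~ exists (A : finType) (X : set (G -> A)),
      [/\ SFT X, weakly_aperiodic X & ~ strongly_aperiodic X].

End Subshifts.

(* Main.v *)
Require Import Defs.
From mathcomp Require Import all_boot all_algebra finmap.
From mathcomp Require Import boolp classical_sets cardinality zify ring.

(** The argument separates into dynamics and group theory.

    Dynamics. Let [kappa : A -> G] be a finite family of labels, and ask of
    [x : G -> A] that every [g] be reached from at least two places [g'] under
    the rule that sends [g'] to [g' * kappa (x g')]. This is a local condition,
    so it defines a subshift of finite type. The rule descends to the orbit of
    [x], where it is a self-map all of whose fibres have two points or more;
    hence the orbit is infinite. To fill this subshift it suffices that [G]
    act on the right on some [Omega] carrying a two-to-one map of the form
    [w |-> w . kappa (xi w)]: the configuration [h |-> xi (w0 . h)] belongs to
    the subshift, and it is fixed by the stabilizer of [w0]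
    ([not_rigid_of_action]).

    Model. On [bool * nat] the permutations [turn false] and [turn true] have
    order three, and the map [(b, n) |-> (~~ b, n / 2)] moves each point by one
    of them or its inverse and is two-to-one. The product of the two turns
    fixes [(false, 0)] but is not the identity.

    Group theory. It remains to make [G] act on [int * (bool * nat)] so that
    turns of each fibre come from elements of [G]; this follows the proof of
    Baumslag and Pride that groups of deficiency at least two are large. With
    two or more generators there are integer degrees [d] on [S] for which the
    relator [r] has degree 0 and some word [t] has degree 1. A generator [s] is
    made to act by [(i, x) |-> (i + d s, turn^(c s i) x)], with exponents
    [c s i] in Z/3. The levels [i] are cut into blocks, turned alternately by
    [turn true] and [turn false], and [c] is required to vanish near the ends
    of the blocks. A short word then meets one kind of turn only, so that it
    acts through the sum of the [c s i] along its path ([run_level_step]).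
    That these sums vanish along [r] and [t] from every level amounts to
    [2 * period] linear equations, whereas there are about
    [#|S| * (2/3) * period] unknowns. Since [#|S| >= 3] the block length can be
    tuned so that the unknowns win ([balanced_cochain]), and a nonzero solution
    exists. Then [r] acts trivially, [t] is the pure shift of levels, and a
    generator at a place where [c] is nonzero, corrected by shifts, is a turn
    of the fibre. *)

Set Implicit Arguments.
Unset Strict Implicit.
Unset Printing Implicit Defensive.

Import GRing.Theory Num.Theory.

Local Open Scope classical_set_scope.
Local Open Scope group_scope.

(** * A dynamical criterion *)

Lemma finite_injective_onto (T : choiceType) (O : set T) (p : T -> T) :
    finite_set O -> (forall y, O y -> O (p y)) ->
    (forall y z, O y -> O z -> p y = p z -> y = z) ->
  forall z, O z -> exists2 y, O y & p y = z.
Proof.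
move=> /finite_fsetP[X ->] pX pinj z zX.
have sub : (p @` X `<=` X)%fset.
  by apply/fsubsetP => _ /imfsetP[y yX ->]; exact: pX.
have : (p @` X == X)%fset.
  by rewrite eqEfcard sub card_in_imfset /= ?leqnn //; exact: pinj.
move=> /eqP E; move: zX; rewrite /= -{1}E => /imfsetP[y yX zE].
by exists y; [exact: yX | rewrite zE].
Qed.

Lemma shift_comp (G : groupType) (A : Type) (g h : G) (x : G -> A) :
  shift g (shift h x) = shift (g * h) x.
Proof. by apply/funext => k; rewrite /shift invgM mulgA. Qed.

Section Doubling.
Variables (G : groupType) (A : finType) (kappa : A -> G).

(** The element [g] has two preimages under [g' |-> g' * kappa (x g')]. They
    are told apart by their labels, so [kappa] may fail to be injective. *)
Definition doubling_at (x : G -> A) (g : G) : Prop :=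
  exists a b : A,
    [/\ a <> b, x (g * (kappa a)^-1) = a & x (g * (kappa b)^-1) = b].

Definition window : {fset G} := [fset (kappa a)^-1 | a in A]%fset.

Lemma windowP a : (kappa a)^-1 \in window.
Proof. exact: in_imfset. Qed.

Definition window_pattern (q : {ffun window -> A}) : {fmap G -> A} := FinMap q.

Definition non_doubling : set {fmap G -> A} :=
  [set window_pattern q | q in [set q : {ffun window -> A} |
     ~ exists a b : A,
       [/\ a <> b, q [` windowP a]%fset = a & q [` windowP b]%fset = b]]].

Lemma finite_non_doubling : finite_set non_doubling.
Proof. by apply: finite_image; exact: finite_finset. Qed.

Lemma doublingP (x : G -> A) :
  subshift non_doubling x <-> forall g, doubling_at x g.
Proof.
split=> [Xx g | dx _ [q nq <-]].
- apply: contrapT => ndx; pose q : {ffun window -> A} := [ffun h => x (g * val h)].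
  apply: (Xx (window_pattern q)); last first.
    by exists g^-1 => h; rewrite /shift invgK ffunE.
  exists q => // -[a [b [ab]]]; rewrite !ffunE => xa xb.
  by apply: ndx; exists a, b.
- move=> [g xq]; apply: nq; have [a [b [ab xa xb]]] := dx g^-1.
  have qE c : q [` windowP c]%fset = x (g^-1 * (kappa c)^-1).
    exact/esym/(xq [` windowP c]%fset).
  by exists a, b; rewrite !qE.
Qed.

(** The rule induces on the orbit of [x] the map [Phi], which recentres a
    translate [y] at the place its origin points to. Each point of the orbit
    has two preimages [p.1] and [p.2] under [Phi]; were the orbit finite,
    the injection given by [p.1] would be onto and would hit a point of the
    form [p.2]. *)
Lemma doubling_not_strongly_periodic (x : G -> A) :
  (forall g, doubling_at x g) -> ~ strongly_periodic x.
Proof.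
move=> dx; rewrite /strongly_periodic; set O := (X in finite_set X) => finO.
pose Phi (y : G -> A) := shift (kappa (y 1))^-1 y.
have pre y : exists p : (G -> A) * (G -> A), O y ->
    [/\ O p.1, O p.2, p.1 <> p.2, Phi p.1 = y & Phi p.2 = y].
  case: (pselect (O y)) => [[g _ gy] | nOy]; last by exists (y, y).
  have [a [b [ab xa xb]]] := dx g^-1.
  exists (shift (kappa a) y, shift (kappa b) y) => _.
  have ya : shift (kappa a) y 1 = a by rewrite /shift mulg1 -gy.
  have yb : shift (kappa b) y 1 = b by rewrite /shift mulg1 -gy.
  split=> /=.
  - by exists (kappa a * g) => //; rewrite -shift_comp gy.
  - by exists (kappa b * g) => //; rewrite -shift_comp gy.
  - by move=> E; apply: ab; rewrite -ya E yb.
  - by rewrite /Phi ya shift_comp mulVg; apply/funext => h; rewrite /shift invg1 mul1g.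
  - by rewrite /Phi yb shift_comp mulVg; apply/funext => h; rewrite /shift invg1 mul1g.
have [p /= pP] := choice pre.
have Ox : O x by exists 1 => //; apply/funext => h; rewrite /shift invg1 mul1g.
have [Op1 Op2 p12 Phi1 Phi2] := pP _ Ox.
have p1inj y z : O y -> O z -> (p y).1 = (p z).1 -> y = z.
  move=> /pP[_ _ _ Ey _] /pP[_ _ _ Ez _] E.
  by rewrite -[LHS]Ey -[RHS]Ez E.
have p1O y : O y -> O (p y).1 by move=> /pP[].
have [z Oz E] := finite_injective_onto finO p1O p1inj Op2.
have [_ _ _ Phiz _] := pP _ Oz.
have xz : x = z by rewrite -[LHS]Phi2 -E.
by apply: p12; rewrite -E xz.
Qed.

End Doubling.

(** The configuration is pulled back from [Omega] along the orbit map of [w0];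
    the stabilizer of [w0] becomes a group of periods. *)
Lemma not_rigid_of_action (G : groupType) (A : finType) (kappa : A -> G)
    (Omega : Type) (act : Omega -> G -> Omega) (xi : Omega -> A)
    (w0 : Omega) (g0 : G) :
    (forall w, act w 1 = w) -> (forall w g h, act w (g * h) = act (act w g) h) ->
    (forall w, exists u v, [/\ xi u <> xi v,
       act u (kappa (xi u)) = w & act v (kappa (xi v)) = w]) ->
    act w0 g0 = w0 -> g0 <> 1 ->
  ~ periodically_rigid G.
Proof.
move=> act1 actM two fix0 g01; apply; exists A, (subshift (non_doubling kappa)).
pose x h := xi (act w0 h).
have dx g : doubling_at kappa x g.
  have [u [v [uv Eu Ev]]] := two (act w0 g).
  have back w : act w (kappa (xi w)) = act w0 g ->
      x (g * (kappa (xi w))^-1) = xi w.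
    by move=> E; rewrite /x actM -E -actM mulgV act1.
  by exists (xi u), (xi v); split; [|exact: back|exact: back].
have Xx : subshift (non_doubling kappa) x by apply/doublingP.
split; first by exists (non_doubling kappa); split=> //; exact: finite_non_doubling.
  split; first by exists x.
  by move=> [y /doublingP]; exact: doubling_not_strongly_periodic.
case=> _; apply; exists x => // Estab.
have : stabilizer x g0.
  have inv0 : act w0 g0^-1 = w0 by rewrite -{1}fix0 -actM mulgV act1.
  by apply/funext => h; rewrite /shift /x actM inv0.
by rewrite Estab.
Qed.

(** * Actions of a group given by one relator *)

Section Presentation.
Variables (S : choiceType) (Omega : Type) (step : Omega -> S * bool -> Omega).
Hypothesis stepK : forall a w, step (step w a) (inv_letter a) = w.

Definition run (w : Omega) (u : word S) : Omega := foldl step w u.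

Lemma run_cons_letter a u w : run w (cons_letter a u) = run (step w a) u.
Proof. by case: u => //= b u; case: eqP => //= ->; rewrite stepK. Qed.

Lemma run_cat_reduce u v w : run w (cat_reduce u v) = run (run w u) v.
Proof. by elim: u w => //= a u IH w; rewrite run_cons_letter IH. Qed.

Lemma run_inv_word u w : run (run w u) (inv_word u) = w.
Proof.
elim: u w => //= a u IH w.
rewrite /inv_word /= rev_cons -cats1 /run foldl_cat /=.
by have := IH (step w a); rewrite /run /inv_word => ->; exact: stepK.
Qed.

Lemma run_word_inv u w : run (run w (inv_word u)) u = w.
Proof. by rewrite -{2}(inv_wordK u) run_inv_word. Qed.

Definition trivial_words : set (free_group S) :=
  [set x | forall w, run w (fg_word x) = w].

Lemma trivial_words_normal : is_normal_subgroup trivial_words.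
Proof.
split=> [|x y Tx Ty w|x Tx w|x g Tx w] //=.
- by rewrite run_cat_reduce Tx Ty.
- by rewrite -{1}(Tx w) run_inv_word.
- by rewrite !run_cat_reduce Tx run_word_inv.
Qed.

(** Words acting trivially form a normal subgroup of the free group, which
    contains the normal closure of [r] as soon as it contains [r]; hence
    the action of words factors through [G]. *)
Lemma presentation_action (G : groupType) (r : word S) :
    one_relator_presentation G r -> (forall w, run w r = w) ->
  exists act : Omega -> G -> Omega,
    [/\ forall w, act w 1 = w,
        forall w g h, act w (g * h) = act (act w g) h
      & forall u, exists g, forall w, act w g = run w u].
Proof.
move=> [f [f' fK f'K]] rT; set N := normal_closure _ in f f' fK f'K.
have NT : nsub_set N `<=` trivial_words.
  apply: smallest_sub; first exact: trivial_words_normal.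
  by move=> _ -> w /=; rewrite run_cat_reduce rT.
pose lift g : free_group S := repr (f g).
have run_eq (x y : free_group S) :
    nsub_set N (x^-1 * y) -> forall w, run w (fg_word x) = run w (fg_word y).
  move=> /NT Txy w; have := Txy (run w (fg_word x)).
  by rewrite /= run_cat_reduce run_inv_word => ->.
have actM w g h :
    run w (fg_word (lift (g * h))) = run (run w (fg_word (lift g))) (fg_word (lift h)).
  rewrite -run_cat_reduce -/(fg_word (lift g * lift h)).
  apply: esym; apply: (run_eq (lift g * lift h) (lift (g * h))).
  rewrite /lift gmulfM; exact: repr_pi.
exists (fun w g => run w (fg_word (lift g))); split=> //.
- move=> w; have := actM (run w (inv_word (fg_word (lift 1)))) 1 1; rewrite mulg1.
  by rewrite !run_word_inv.
- move=> u; pose x := free_of_word u; exists (f' (\pi_(quotient_group N) x)%qT) => w.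
  rewrite /lift f'K -(run_eq x); last exact: repr_pi.
  by rewrite /= run_cat_reduce.
Qed.

End Presentation.

Local Open Scope ring_scope.

(** * Two rotations of order three *)

(** The cycles of [turn b] are
    [(b, n) -> (~~ b, 2 n) -> (~~ b, 2 n + 1) -> (b, n)]: each joins a point of
    the sheet [b] to the two points of the other sheet that halve to it. *)
Definition turn (b : bool) (x : bool * nat) : bool * nat :=
  if x.1 == b then (~~ b, x.2.*2)
  else if odd x.2 then (b, x.2./2) else (~~ b, x.2.+1).

Lemma turn_even b n : turn b (b, n) = (~~ b, n.*2).
Proof. by rewrite /turn eqxx. Qed.

Lemma turn_odd b n : turn b (~~ b, n.*2.+1) = (b, n).
Proof.
by rewrite /turn /= odd_double /= uphalf_double; case: b.
Qed.

Lemma turn3 b x : iter 3 (turn b) x = x.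
Proof.
have tE n : turn b (~~ b, n.*2) = (~~ b, n.*2.+1).
  by rewrite /turn /= odd_double; case: b.
case: x => b' n; have [->|nb] := eqVneq b' b.
  by rewrite /= turn_even tE turn_odd.
have -> : b' = ~~ b by case: (b) (b') nb => [] [].
rewrite -[n]odd_double_half; case: (odd n).
  by rewrite add1n /= turn_odd turn_even tE.
by rewrite add0n /= tE turn_odd turn_even.
Qed.

Definition turns b (k : 'Z_3) : bool * nat -> bool * nat := iter k (turn b).

Lemma turnsD b k l x : turns b (k + l) x = turns b l (turns b k x).
Proof.
rewrite /turns -iterD addnC.
have mod3 n : iter (n %% 3) (turn b) x = iter n (turn b) x.
  rewrite {2}(divn_eq n 3) addnC iterD; congr iter.
  by elim: (n %/ 3)%N => // m IH; rewrite mulSn iterD -IH turn3.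
exact: mod3.
Qed.

Lemma Z3_neq0 (k : 'Z_3) : k <> 0 -> k = 1 \/ k + k = 1.
Proof.
case: k => -[|[|[|//]]] lt3 k0; [|left|right]; try exact: val_inj.
by case: k0; apply: val_inj.
Qed.

(** * Levels and cochains on words *)

Section Degree.
Variables (S : finType) (d : S -> int).
Implicit Types (a : S * bool) (u : word S) (c : S -> int -> 'Z_3).

Definition letter_deg a : int := if a.2 then d a.1 else - d a.1.
Definition deg u : int := \sum_(a <- u) letter_deg a.
Definition variation u : int := \sum_(a <- u) `|d a.1|.

(** A word traces a path of levels. The letter [s^-1] runs backwards along an
    edge of [s], so its exponent and its block are read at the tail of that
    edge, which is the level where the letter arrives. *)
Definition tail_level (i : int) a : int := if a.2 then i else i - d a.1.
Definition edge_value c (i : int) a : 'Z_3 :=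
  if a.2 then c a.1 i else - c a.1 (i - d a.1).
Fixpoint path_sum c (i : int) u : 'Z_3 :=
  if u is a :: u' then edge_value c i a + path_sum c (i + letter_deg a) u' else 0.

Lemma path_sumB c c1 c2 i u : (forall s j, c s j = c1 s j - c2 s j) ->
  path_sum c i u = path_sum c1 i u - path_sum c2 i u.
Proof.
move=> cE; elim: u i => [|a u IH] i /=; first by rewrite subr0.
by rewrite IH /edge_value !cE; case: a.2; ring.
Qed.

Lemma path_sum_periodic c (N : int) : (forall s j, c s (j + N) = c s j) ->
  forall i u, path_sum c (i + N) u = path_sum c i u.
Proof.
move=> cN i u; elim: u i => //= a u IH i.
rewrite [i + N + _]addrAC IH; congr (_ + _).
by rewrite /edge_value [i + N - _]addrAC !cN.
Qed.

Variables (side : int -> bool) (c : S -> int -> 'Z_3).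

Definition level_step (w : int * (bool * nat)) a : int * (bool * nat) :=
  (w.1 + letter_deg a, turns (side (tail_level w.1 a)) (edge_value c w.1 a) w.2).

Lemma level_stepK a w : level_step (level_step w a) (inv_letter a) = w.
Proof.
case: w a => i x [s []]; rewrite /level_step /letter_deg /tail_level /edge_value /=.
  by rewrite addrK -turnsD subrr.
by rewrite subrK -turnsD addNr.
Qed.

(** Turns of the two kinds do not commute, but a path that stays within [L] of
    the level [i] only uses nonzero exponents in the block of [i], so its
    turns are all of one kind and their exponents add up. *)
Lemma run_level_step (L : int) :
    (forall s i j, `|i - j| <= L -> c s j = 0 \/ side j = side i) ->
  forall i j x u, `|i - j| + variation u <= L ->
  run level_step (j, x) u = (j + deg u, turns (side i) (path_sum c j u) x).
Proof.
move=> conf i j x u; elim: u j x => [|a u IH] j x.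
  by rewrite /deg big_nil addr0.
rewrite {1}/variation big_cons -/(variation u) => hL /=.
have var_ge0 : 0 <= variation u by apply: sumr_ge0.
have tail_near : `|i - tail_level j a| <= L.
  by rewrite /tail_level; case: a.2; lia.
have head_near : `|i - (j + letter_deg a)| + variation u <= L.
  by rewrite /letter_deg; case: a.2; lia.
rewrite {1}/deg big_cons -/(deg u).
rewrite /level_step /= -/level_step IH // addrA turnsD; congr (_, turns _ _ _).
have [c0|->//] := conf a.1 _ _ tail_near.
suff -> : edge_value c j a = 0 by [].
by move: c0; rewrite /edge_value /tail_level; case: a.2 => ->; rewrite ?oppr0.
Qed.

End Degree.

(** * Degrees that kill the relator *)

Lemma deg_cat (S : finType) (d : S -> int) u v : deg d (u ++ v) = deg d u + deg d v.
Proof. exact: big_cat. Qed.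

Lemma word_power (S : finType) (s : S) (z : int) :
  exists u : word S, forall d, deg d u = z * d s.
Proof.
exists (nseq `|z|%N (s, 0 <= z)) => d.
rewrite /deg big_nseq iter_addr_0 /letter_deg -mulr_natr /=.
by case: (lerP 0 z); lia.
Qed.

Lemma deg_two_letters (S : finType) (a b : S) (x y : int) (r : word S) : a != b ->
  let e s := deg (fun s' => (s' == s)%:R) r in
  deg (fun s => if s == a then x else if s == b then y else 0) r = e a * x + e b * y.
Proof.
move=> ab /=; elim: r => [|l r]; first by rewrite /deg !big_nil; ring.
rewrite /deg !big_cons /letter_deg => ->; case: l => s o /=.
have [->|_] := eqVneq s a; last by case: (s == b); case: o => /=; ring.
by rewrite (negPf ab); case: o => /=; ring.
Qed.

(** Let [e a] and [e b] be the exponent sums of two generators in [r], and [g]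
    their gcd. If [e a] vanishes, counting the letters [a] will do; otherwise
    the degrees [e b / g] and [- e a / g] annihilate [r] and are coprime, and
    Bezout coefficients give a word of degree 1. *)
Lemma degree_killing_relator (S : finType) (r : word S) : (1 < #|S|)%N ->
  exists (d : S -> int) (t : word S), deg d r = 0 /\ deg d t = 1.
Proof.
case/card_gt1P => a [b [_ _ ab]].
pose e s := deg (fun s' => (s' == s)%:R) r.
have [x [y [u [v [exy uv]]]]] : exists x y u v : int,
    e a * x + e b * y = 0 /\ u * x + v * y = 1.
  have [ea0|ea0] := eqVneq (e a) 0.
    by exists 1, 0, 1, 0; rewrite ea0; split; ring.
  have [u [v uv]] := Bezoutz (e a) (e b).
  have g0 : gcdz (e a) (e b) != 0 by rewrite gcdz_eq0 (negPf ea0).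
  have /dvdzP[p pE] := dvdz_gcdl (e a) (e b).
  have /dvdzP[q qE] := dvdz_gcdr (e a) (e b).
  move: uv g0 pE qE; move: (gcdz _ _) => g uv g0 pE qE.
  exists q, (- p), v, (- u); rewrite pE qE in uv *; split; first by ring.
  by apply: (mulIf g0); rewrite mul1r -[RHS]uv; ring.
have [ua uaE] := word_power a u; have [vb vbE] := word_power b v.
exists (fun s => if s == a then x else if s == b then y else 0), (ua ++ vb).
rewrite deg_two_letters // deg_cat uaE vbE eqxx eq_sym (negPf ab) eqxx.
by split.
Qed.

(** * Balanced cochains *)

(** A homogeneous system with more unknowns than equations has a nonzero
    solution; over a finite ring this is the pigeonhole principle. *)
Lemma nontrivial_kernel (I J : finType)
    (phi : {ffun I -> 'Z_3} -> {ffun J -> 'Z_3}) :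
    {morph phi : f g / f - g} -> (#|J| < #|I|)%N ->
  exists2 f, f != 0 & phi f = 0.
Proof.
move=> phiB JI; have : ~~ injectiveb phi.
  apply/negP => /injectiveP /leq_card; rewrite !card_ffun card_ord leqNgt.
  by rewrite ltn_exp2l ?JI.
case/injectivePn => f [g fg E]; exists (f - g); first by rewrite subr_eq0.
by rewrite phiB E subrr.
Qed.

Section Blocks.
Variables (S : finType) (L : nat).

(** Blocks have length [6 L + 1], and the exponents live on the [4 L + 1] levels
    at distance at least [L] from both ends of the block. For three generators
    this leaves [12 L + 3] unknowns against [12 L + 2] equations. *)
Definition period : nat := (6 * L).+1.
Definition block_side (i : int) : bool := odd `|(i %/ period)%Z|.
Definition inner_cochain (f : {ffun S * 'I_(4 * L).+1 -> 'Z_3}) (s : S) (i : int) : 'Z_3 :=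
  let k := `|(i %% period)%Z|%N in
  if (L <= k < (5 * L).+1)%N then f (s, inord (k - L)) else 0.

Lemma inner_cochain_periodic f s (i q : int) :
  inner_cochain f s (i + q * period) = inner_cochain f s i.
Proof. by rewrite /inner_cochain addrC modzMDl. Qed.

Lemma block_side_periods (i q : int) :
  block_side (i + q * period) = odd `|q|%N (+) block_side i.
Proof. by rewrite /block_side addrC divzMDl //; lia. Qed.

Lemma inner_cochain_confined f s (i j : int) : `|i - j| <= L%:Z ->
  inner_cochain f s j = 0 \/ block_side j = block_side i.
Proof.
move=> near; rewrite /inner_cochain; case: ifP => inner; [right | by left].
have nonneg : 0 <= (j %% period)%Z by rewrite modz_ge0.
congr (odd `|_|%N); move: inner near nonneg; rewrite /period; nia.
Qed.

(** By periodicity the vanishing of the path sums need only be imposed at one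
    starting level for each residue, which makes the system finite. *)
Lemma balanced_cochain (d : S -> int) (r t : word S) : (2 < #|S|)%N ->
  exists f, [/\ exists s i, inner_cochain f s i <> 0,
    forall i, path_sum d (inner_cochain f) i r = 0
  & forall i, path_sum d (inner_cochain f) i t = 0].
Proof.
move=> S3; pose phi (f : {ffun S * 'I_(4 * L).+1 -> 'Z_3}) :=
  [ffun q : bool * 'I_period =>
     path_sum d (inner_cochain f) (q.2 : nat)%:Z (if q.1 then r else t)].
have phiB : {morph phi : f g / f - g}.
  move=> f g; apply/ffunP => q; rewrite !ffunE; apply: path_sumB => s j.
  by rewrite /inner_cochain; case: ifP; rewrite ?subr0 // !ffunE.
have [|f f0 phif0] := nontrivial_kernel phiB.
  by rewrite !card_prod card_bool !card_ord /period; nia.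
have sum0 o i : path_sum d (inner_cochain f) i (if o then r else t) = 0.
  have lt_k : (`|(i %% period)%Z| < period)%N by rewrite /period; lia.
  have /ffunP/(_ (o, Ordinal lt_k)) := phif0; rewrite !ffunE /= => <-.
  have iE : i = `|(i %% period)%Z|%:Z + (i %/ period)%Z * period.
    by rewrite /period; lia.
  rewrite {1}iE; apply: path_sum_periodic => s j; exact: inner_cochain_periodic.
exists f; split; [|exact: (sum0 true)|exact: (sum0 false)].
apply: contra_notP (negP f0) => c0; apply/eqP/ffunP => -[s k].
rewrite ffunE; apply: contrapT => fk; apply: c0; exists s, (k + L)%N%:Z.
have kL : (`|((k + L)%N%:Z %% period)%Z| = k + L)%N.
  by rewrite modz_nat /= modn_small // /period; case: k {fk} => /=; lia.
rewrite /inner_cochain kL addnK inord_val ifT //; case: k {fk kL} => /=; lia.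
Qed.

End Blocks.

(** * From turns of the fibres to non-rigidity *)

Section FiberAction.
Variables (G : groupType) (act : int * (bool * nat) -> G -> int * (bool * nat)).
Hypothesis act1 : forall w, act w 1%g = w.
Hypothesis actM : forall w g h, act w (g * h)%g = act (act w g) h.

Lemma actV w w' g : act w g = w' -> act w' g^-1%g = w.
Proof. by move=> <-; rewrite -actM mulgV act1. Qed.

Lemma level_shifts (t : G) : (forall i x, act (i, x) t = (i + 1, x)) ->
  forall z : int, exists g, forall i x, act (i, x) g = (i + z, x).
Proof.
move=> tE; have nat_shift (n : nat) : exists g, forall i x, act (i, x) g = (i + n%:Z, x).
  elim: n => [|n [g gE]]; first by exists 1%g => i x; rewrite act1 addr0.
  by exists (g * t)%g => i x; rewrite actM gE tE -addrA intS [1 + _]addrC.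
case=> n; first exact: nat_shift.
have [g gE] := nat_shift n.+1; exists g^-1%g => i x.
by apply: actV; rewrite gE NegzE subrK.
Qed.

(** The labels record the residue of the level, the sheet and the parity, which
    is what is needed to select the group element that realizes
    [(b, n) |-> (~~ b, n / 2)] in the fibre of a given level. *)
Lemma not_rigid_of_fiber_turns (m : nat) :
    (forall i b, exists v, forall (q : int) x,
       act (i + q * m.+1%:Z, x) v = (i + q * m.+1%:Z, turn b x)) ->
  ~ periodically_rigid G.
Proof.
move=> turners; have {turners} : forall p : 'I_m.+1 * bool, exists v,
    forall (q : int) x, act ((p.1 : nat)%:Z + q * m.+1%:Z, x) v =
      ((p.1 : nat)%:Z + q * m.+1%:Z, turn p.2 x).
  by move=> p; exact: turners.
move=> /choice[v vE]; pose res (i : int) : 'I_m.+1 := inord `|(i %% m.+1)%Z|.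
have turnE i b x : act (i, x) (v (res i, b)) = (i, turn b x).
  have := vE (res i, b) (i %/ m.+1)%Z x; rewrite /= inordK; last by lia.
  by have -> : `|(i %% m.+1)%Z|%:Z + (i %/ m.+1)%Z * m.+1%:Z = i by lia.
pose A : finType := ('I_m.+1 * bool * bool)%type.
pose kappa (a : A) :=
  let g := v (a.1.1, ~~ a.1.2) in if a.2 then g else g^-1%g.
pose xi (w : int * (bool * nat)) : A := (res w.1, w.2.1, odd w.2.2).
apply: (@not_rigid_of_action G A kappa _ act xi (0, (false, 0%N))
          (v (res 0, false) * v (res 0, true))%g) => //.
- case=> i [b n]; exists (i, (~~ b, n.*2.+1)), (i, (~~ b, n.*2)).
  rewrite /kappa /xi /= odd_double negbK /=; split=> //.
    by rewrite turnE turn_odd.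
  by apply: actV; rewrite turnE turn_even.
- by rewrite actM !turnE.
- move=> g1; have := actM (0, (false, 1%N)) (v (res 0, false)) (v (res 0, true)).
  by rewrite g1 act1 !turnE.
Qed.

End FiberAction.

Local Close Scope ring_scope.
Local Close Scope group_scope.
Local Close Scope classical_set_scope.

Theorem theorem1 (G : groupType) (S : finType) (r : seq (S * bool))
    (hS : 3 <= #|S|) (hr : cyclically_reduced r) (hr0 : r <> [::])
    (hG : one_relator_presentation G r) :
  ~ periodically_rigid G.
Proof.
have [d [t [degr degt]]] := degree_killing_relator r (ltnW hS).
(* No path along [r] or [t] strays further than its variation. *)
pose L := `|(variation d r + variation d t)%R|%N.
have [f [[s [i0 c_neq0]] sumr sumt]] := balanced_cochain L d r t hS.
have conf := @inner_cochain_confined S L f.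
pose step := level_step d (block_side L) (inner_cochain f).
have var_ge0 u : (0 <= variation d u)%R by apply: sumr_ge0.
have runr w : run step w r = w.
  case: w => i x; rewrite (run_level_step conf (i := i)) ?degr ?addr0 ?sumr //.
  by rewrite subrr normr0 /L; have := var_ge0 r; have := var_ge0 t; lia.
have runt i x : run step (i, x) t = (i + 1, x)%R.
  rewrite (run_level_step conf (i := i)) ?degt ?sumt //.
  by rewrite subrr normr0 /L; have := var_ge0 r; have := var_ge0 t; lia.
have [act [act1 actM actE]] :=
  presentation_action (@level_stepK _ d (block_side L) (inner_cochain f)) hG runr.
have [gt gtE] := actE t; have [gs gsE] := actE [:: (s, true)].
have shifts := level_shifts act1 actM (t := gt).
have {}shifts z : exists g, forall i x, act (i, x) g = (i + z, x)%R.
  by apply: shifts => i x; rewrite gtE runt.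
(* Block sides alternate, so the action is periodic in the level with twice the
   block length as period. *)
apply: (not_rigid_of_fiber_turns act1 actM (m := (12 * L).+1)) => i b.
have mE (q : int) : (q * (12 * L).+2%:Z = (q * 2) * period L)%R.
  by rewrite /period; lia.
pose k := inner_cochain f s i0.
(* Shift to a copy of the level [i0] lying in a block of side [b], apply the
   generator [s], and shift back. *)
have [v vE] : exists v, forall (q : int) x,
    (act (i + q * (12 * L).+2%:Z, x) v = (i + q * (12 * L).+2%:Z, turns b k x))%R.
  pose e : int := (block_side L i0 (+) b)%:Z; pose j := (i0 + e * period L)%R.
  have [h hE] := shifts (j - i)%R; have [h' h'E] := shifts (i - j - d s)%R.
  exists (h * gs * h')%g => q x; rewrite !actM hE gsE /= h'E !mE.
  have -> : (i + q * 2 * period L + (j - i) = i0 + (e + q * 2) * period L)%R.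
    by rewrite /j; ring.
  rewrite /step /level_step /letter_deg /tail_level /edge_value /=.
  rewrite inner_cochain_periodic block_side_periods; congr (_, turns _ _ _).
    by rewrite /j; ring.
  have -> : odd `|(e + q * 2)%R|%N = block_side L i0 (+) b.
    by rewrite /e; case: (_ (+) b); lia.
  by rewrite addbC addbA addbb.
have [k1|k2] := Z3_neq0 c_neq0; first by exists v => q x; rewrite vE /k k1.
by exists (v * v)%g => q x; rewrite actM !vE -turnsD /k k2.
Qed.
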